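(* Let $L,M,N$ be positive integers and let $g:=\{g_l\}_{l\in\mathbb{N}_L}\subset\ell^2(\mathbb{Z}\times\mathbb{Z},\mathbb{R})$. Then the following statements are equivalent: 1. $\mathcal{G}(g,L,M,N)$ is an orthonormal basis for $\ell^2(\mathbb{Z}\times\mathbb{Z},\mathbb{H})$. 2. Both of the following hold: (a) $N^2=LM^2$; (b) for all $k\in\mathbb{N}_N^2$ and $p\in\mathbb{Z}^2$, $$\left(\sum_{l\in\mathbb{N}_L}\mathcal{M}_{g_l}(k)\mathcal{M}_{g_l}^t(k)\right)_{0_{\mathbb{Z}^2},p}=\frac{1}{M^2}\chi_{\{0_{\mathbb{Z}^2}\}}(p).$$
   Context: $\mathbb{H}$ is the algebra of real quaternions with imaginary units $i,j,ij$. For a positive integer $K$, $\mathbb{N}_K:=\{0,1,\dots,K-1\}$. $\ell^2(\mathbb{Z}\times\mathbb{Z},\mathbb{H})$ is the right quaternionic Hilbert space of functions $f:\mathbb{Z}^2\to\mathbb{H}$ with $\sum_{k\in\mathbb{Z}^2}|f(k)|^2<\infty$, with inner product $\langle f,g\rangle=\sum_{k\in\mathbb{Z}^2}\overline{f(k)}\,g(k)$ and scalars acting on the right; $\ell^2(\mathbb{Z}\times\mathbb{Z},\mathbb{R})$ is the subset of real-valued ones. For $n\in\mathbb{Z}^2$, $(T_{nN}f)(k)=f(k-nN)$ where $nN=(n_1N,n_2N)$. For $m=(m_1,m_2)\in\mathbb{N}_M^2$, $(E_{\frac mM}f)(k)=e^{2\pi i\frac{m_1}{M}k_1}f(k)e^{2\pi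 j\frac{m_2}{M}k_2}$, $k=(k_1,k_2)\in\mathbb{Z}^2$. The Gabor system is the indexed family $\mathcal{G}(g,L,M,N):=\{E_{\frac mM}T_{nN}g_l\}_{l\in\mathbb{N}_L,\,m\in\mathbb{N}_M^2,\,n\in\mathbb{Z}^2}$. For $h\in\ell^2(\mathbb{Z}\times\mathbb{Z},\mathbb{H})$ and $k\in\mathbb{Z}^2$, $\mathcal{M}_h(k)$ is the matrix indexed by $\mathbb{Z}^2\times\mathbb{Z}^2$ with entries $(\mathcal{M}_h(k))_{p,n}=h(k+pM-nN)$, $p,n\in\mathbb{Z}^2$; $^t$ denotes transpose, so $(\mathcal{M}_{g_l}(k)\mathcal{M}_{g_l}^t(k))_{0_{\mathbb{Z}^2},p}=\sum_{n\in\mathbb{Z}^2}g_l(k-nN)g_l(k+pM-nN)$. $0_{\mathbb{Z}^2}=(0,0)$ and $\chi_E$ is the indicator function of $E$. *)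

(* Defs.v *)
From HB Require Import structures.
From mathcomp Require Import all_boot all_order all_algebra.
From mathcomp Require Import all_classical all_reals all_analysis.
From mathcomp Require Import ring.

Set Implicit Arguments.
Unset Strict Implicit.
Unset Printing Implicit Defensive.

Import Order.TTheory GRing.Theory Num.Theory.

Local Open Scope classical_set_scope.
Local Open Scope ring_scope.

(* [Quat a b c d] is a + b i + c j + d ij. *)
Record quat (R : Type) : Type := Quat { q0 : R; q1 : R; q2 : R; q3 : R }.

Section quat_choice.
Variable R : choiceType.

Definition tuple_of_quat (x : quat R) : R * R * R * R :=
  (q0 x, q1 x, q2 x, q3 x).
Definition quat_of_tuple (t : R * R * R * R) : quat R :=
  let: (a, b, c, d) := t in Quat a b c d.

Lemma tuple_of_quatK : cancel tuple_of_quat quat_of_tuple.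
Proof. by case. Qed.

HB.instance Definition _ := Choice.copy (quat R) (can_type tuple_of_quatK).
End quat_choice.

Section quat_ring.
Variable R : realType.
Implicit Types x y z : quat R.

Definition addq x y :=
  Quat (q0 x + q0 y) (q1 x + q1 y) (q2 x + q2 y) (q3 x + q3 y).
Definition oppq x := Quat (- q0 x) (- q1 x) (- q2 x) (- q3 x).
Definition zeroq : quat R := Quat 0 0 0 0.
Definition oneq : quat R := Quat 1 0 0 0.

(* Hamilton product: i^2 = j^2 = -1, ji = - ij. *)
Definition mulq x y := Quat
  (q0 x * q0 y - q1 x * q1 y - q2 x * q2 y - q3 x * q3 y)
  (q0 x * q1 y + q1 x * q0 y + q2 x * q3 y - q3 x * q2 y)
  (q0 x * q2 y - q1 x * q3 y + q2 x * q0 y + q3 x * q1 y)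
  (q0 x * q3 y + q1 x * q2 y - q2 x * q1 y + q3 x * q0 y).

Lemma addqA : associative addq.
Proof. by move=> x y z; rewrite /addq /= !addrA. Qed.

Lemma addqC : commutative addq.
Proof. by move=> x y; congr Quat; exact: addrC. Qed.

Lemma add0q : left_id zeroq addq.
Proof. by case=> a b c d; rewrite /addq /= !add0r. Qed.

Lemma addNq : left_inverse zeroq oppq addq.
Proof. by case=> a b c d; rewrite /addq /= !addNr. Qed.

HB.instance Definition _ :=
  GRing.isZmodule.Build (quat R) addqA addqC add0q addNq.

Lemma mulqA : associative mulq.
Proof. by move=> x y z; congr Quat => /=; ring. Qed.

Lemma mul1q : left_id oneq mulq.
Proof. by case=> a b c d; congr Quat => /=; ring. Qed.

Lemma mulq1 : right_id oneq mulq.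
Proof. by case=> a b c d; congr Quat => /=; ring. Qed.

Lemma mulqDl : left_distributive mulq addq.
Proof. by move=> x y z; congr Quat => /=; ring. Qed.

Lemma mulqDr : right_distributive mulq addq.
Proof. by move=> x y z; congr Quat => /=; ring. Qed.

Lemma oneq_neq0 : oneq != zeroq.
Proof. by apply/eqP => -[] /eqP; rewrite oner_eq0. Qed.

HB.instance Definition _ := GRing.Zmodule_isNzRing.Build (quat R)
  mulqA mul1q mulq1 mulqDl mulqDr oneq_neq0.

End quat_ring.

Section quat_analysis.
Variable R : realType.

Definition rquat (r : R) : quat R := Quat r 0 0 0.
Definition iq : quat R := Quat 0 1 0 0.
Definition jq : quat R := Quat 0 0 1 0.

Definition conjq (x : quat R) : quat R := Quat (q0 x) (- q1 x) (- q2 x) (- q3 x).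

Definition absq (x : quat R) : R :=
  Num.sqrt (q0 x ^+ 2 + q1 x ^+ 2 + q2 x ^+ 2 + q3 x ^+ 2).

(* e^{ut} for an imaginary unit u (u^2 = -1). *)
Definition expq (u : quat R) (t : R) : quat R := rquat (cos t) + u * rquat (sin t).

(* Unconditional sum of an absolutely summable family of reals; the value is
   meaningless when the family is not absolutely summable. *)
Definition rsum (T : choiceType) (f : T -> R) : R :=
  fine (\esum_(k in [set: T]) ((EFin \o f)^\+)%E k) -
  fine (\esum_(k in [set: T]) ((EFin \o f)^\-)%E k).

Definition qsum (T : choiceType) (f : T -> quat R) : quat R :=
  Quat (rsum (fun k => q0 (f k))) (rsum (fun k => q1 (f k)))
       (rsum (fun k => q2 (f k))) (rsum (fun k => q3 (f k))).

End quat_analysis.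

Notation Z2 := (int * int)%type.

Section l2.
Variable R : realType.
Implicit Types f g : Z2 -> quat R.

Definition l2 f : Prop := summable [set: Z2] (fun k => (absq (f k) ^+ 2)%:E).

Definition real_valued f : Prop := forall k, exists r : R, f k = rquat r.

Definition l2_inner f g : quat R := qsum (fun k => conjq (f k) * g k).

(* <f, f> is a nonnegative real quaternion. *)
Definition l2_norm f : R := Num.sqrt (q0 (l2_inner f f)).

(* Finite right-linear combination: scalars act on the right. *)
Definition right_comb (I : Type) (u : I -> Z2 -> quat R)
    (s : seq I) (c : I -> quat R) : Z2 -> quat R :=
  fun k => \sum_(a <- s) u a k * c a.

(* Orthonormality as an indexed family (so repetitions are excluded), together
   with density of the right quaternionic span. *)
Definition orthonormal_basis (I : eqType) (u : I -> Z2 -> quat R) : Prop :=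
  [/\ forall a, l2 (u a),
      forall a b, l2_inner (u a) (u b) = (a == b)%:R
    & forall f, l2 f -> forall e : R, 0 < e ->
        exists (s : seq I) (c : I -> quat R),
          l2_norm (fun k => f k - right_comb u s c k) < e].

End l2.

Definition ord_Z2 (K : nat) (m : 'I_K * 'I_K) : Z2 := (Posz m.1, Posz m.2).

Section gabor.
Variable R : realType.

Definition translation (n : Z2) (f : Z2 -> quat R) : Z2 -> quat R :=
  fun k => f (k - n).

Definition modulation (M : nat) (m : 'I_M * 'I_M) (f : Z2 -> quat R) :
    Z2 -> quat R :=
  fun k => expq (iq R) (2 * pi * (m.1%:R / M%:R) * k.1%:~R) * f k *
           expq (jq R) (2 * pi * (m.2%:R / M%:R) * k.2%:~R).

Definition gabor_system (L M N : nat) (g : 'I_L -> Z2 -> quat R)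
    (a : 'I_L * ('I_M * 'I_M) * Z2) : Z2 -> quat R :=
  let: (l, m, n) := a in modulation m (translation (n *+ N) (g l)).

Definition infmx := Z2 -> Z2 -> quat R.

Definition infmx_mul (A B : infmx) : infmx :=
  fun p q => qsum (fun n => A p n * B n q).

Definition infmx_tr (A : infmx) : infmx := fun p q => A q p.

Definition infmx_sum (L : nat) (A : 'I_L -> infmx) : infmx :=
  fun p q => \sum_(l < L) A l p q.

Definition gabor_mx (M N : nat) (h : Z2 -> quat R) (k : Z2) : infmx :=
  fun p n => h (k + p *+ M - n *+ N).

End gabor.

Arguments gabor_system {R L} M N g a.

(* Main.v *)
(* Let K_B(k, k') be the sum of u_a(k) * conj(u_a(k')) over the elements
   u_a = E_(m/M) T_(nN) g_l with n in the finite set B.  The windows being real,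
   the sum over m can be carried out and gives the real number
     K_B(k, k') = M^2 [M | k - k'] sum_(n in B) sum_l g_l(k - nN) g_l(k' - nN),
   so that (b) says exactly that K_B(k, k') tends to delta_(k, k') as B grows.
   If the system is an orthonormal basis, expanding a point mass gives this limit.
   Conversely the limit gives Parseval's identity for finitely supported vectors,
   hence Bessel's inequality; in particular |g_l|^2 <= 1.  Taking p = 0 in (b) and
   summing over k in N_N^2 gives sum_l |g_l|^2 = N^2 / M^2, so N^2 = L M^2 holds
   if and only if all the |g_l| are 1.  Bessel's inequality for f = u_a then forces
   the other coefficients of u_a to vanish, and Parseval's identity gives density. *)
Require Import Defs.
From mathcomp Require Import all_boot all_order all_algebra finmap.
From mathcomp Require Import all_classical all_reals all_analysis.
From mathcomp Require Import ring lra.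
Set Implicit Arguments.
Unset Strict Implicit.
Unset Printing Implicit Defensive.

Import Order.TTheory GRing.Theory Num.Theory.
Local Open Scope classical_set_scope.
Local Open Scope ring_scope.

(** * Absolutely convergent sums of reals *)

Section real_sums.
Context {R : realType} {T : choiceType}.
Implicit Types (f g : T -> R) (A B : {fset T}).

Definition summ f := summable [set: T] (EFin \o f).

Lemma esum_fset_le (f : T -> R) A : (forall x, 0 <= f x) ->
  ((\sum_(x <- A) f x)%:E <= \esum_(x in [set: T]) (f x)%:E)%E.
Proof.
move=> f0; apply: esum_ge; exists [set` A]; first by split.
by rewrite fsbig_finite// set_fsetK sumEFin.
Qed.

(** Trades the supremum in the extended reals for a uniform bound on finite real sums; the closure
    properties of [summ] then follow by finite arithmetic. *)
Lemma summP f :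
  summ f <-> exists C, forall A, \sum_(x <- A) `|f x| <= C.
Proof.
split=> [|[C fC]]; rewrite /summ.
- rewrite summableE => fin; exists (fine (\esum_(x in [set: T]) (`|f x|)%:E)%E) => A.
  by rewrite -lee_fin fineK //; apply: esum_fset_le.
- apply: (@le_lt_trans _ _ C%:E); last exact: ltry.
  apply: ge_ereal_sup => /= _ [X [finX _] <-].
  by rewrite fsbig_finite// sumEFin lee_fin fC.
Qed.

Lemma summ_le f g : (forall x, `|f x| <= g x) -> summ g -> summ f.
Proof.
move=> fg /summP[C gC]; apply/summP; exists C => A; apply: le_trans (gC A).
by apply: ler_sum => x _; apply: le_trans (fg x) (ler_norm _).
Qed.

Lemma summD f g : summ f -> summ g -> summ (fun x => f x + g x).
Proof.
move=> /summP[C fC] /summP[D gD]; apply/summP; exists (C + D) => A.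
apply: le_trans (lerD (fC A) (gD A)); rewrite -big_split/=.
by apply: ler_sum => x _; apply: ler_normD.
Qed.

Lemma summZ c f : summ f -> summ (fun x => c * f x).
Proof.
move=> /summP[C fC]; apply/summP; exists (`|c| * C) => A.
by under eq_bigr do rewrite normrM; rewrite -mulr_sumr ler_wpM2l.
Qed.

Lemma summN f : summ f -> summ (fun x => - f x).
Proof.
by move=> /(summZ (-1)); congr summ; apply/funext => x; rewrite mulN1r.
Qed.

Lemma summ_inj (h : T -> T) f : injective h -> summ f -> summ (f \o h).
Proof.
move=> hinj /summP[C fC]; apply/summP; exists C => A.
by have := fC (h @` A)%fset; rewrite big_imfset// => x y _ _; exact: hinj.
Qed.

Lemma rsum_ge0E f : (forall x, 0 <= f x) ->
  rsum f = fine (\esum_(x in [set: T]) (f x)%:E)%E.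
Proof.
move=> f0; rewrite /rsum (@eq_esum _ _ _ _ (EFin \o f)) => [|x _]; last first.
  by rewrite funeposE /= max_l// lee_fin.
rewrite (@eq_esum _ _ _ ((EFin \o f)^\-)%E (fun=> 0%E)) => [|x _]; last first.
  by rewrite funenegE; apply/max_idPr; rewrite lee_fin oppr_le0.
by rewrite (@esum1 _ _ _ (fun=> 0%E))//= subr0.
Qed.

Lemma esum_ge0E f : (forall x, 0 <= f x) -> summ f ->
  (\esum_(x in [set: T]) (f x)%:E)%E = (rsum f)%:E.
Proof.
move=> f0; rewrite /summ summableE => fin.
rewrite rsum_ge0E// fineK//.
by move: fin; rewrite (@eq_esum _ _ _ _ (EFin \o f))// => x _ /=; rewrite ger0_norm.
Qed.

Lemma rsum_fset_le f A : (forall x, 0 <= f x) -> summ f ->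
  \sum_(x <- A) f x <= rsum f.
Proof. by move=> f0 sf; rewrite -lee_fin -esum_ge0E// esum_fset_le. Qed.

Lemma ler_sum_fset f A B : (forall x, 0 <= f x) -> (A `<=` B)%fset ->
  \sum_(x <- A) f x <= \sum_(x <- B) f x.
Proof.
move=> f0 AB; rewrite (big_fsetID _ (mem A) B)/=.
have -> : [fset x | x in B & x \in A]%fset = A.
  by apply/fsetP => x; rewrite !inE/= andb_idl// => /(fsubsetP AB).
by rewrite lerDl sumr_ge0.
Qed.

(** Some finite set comes within [e] of the supremum, and enlarging it can only increase the partial
    sum of a nonnegative family. *)
Let rsum_approx_ge0 f : (forall x, 0 <= f x) -> summ f ->
  forall e : R, 0 < e -> exists A0, forall A, (A0 `<=` A)%fset ->
    `|\sum_(x <- A) f x - rsum f| < e.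
Proof.
move=> f0 sf e e0.
have : ((rsum f - e)%:E < \esum_(x in [set: T]) (f x)%:E)%E.
  by rewrite esum_ge0E// lte_fin; lra.
move=> /ereal_sup_gt[_ [X [finX _] <-]].
rewrite fsbig_finite// sumEFin lte_fin => ltX; exists (fset_set X) => A XA.
have le1 := rsum_fset_le A f0 sf.
have : \sum_(x <- fset_set X) f x <= \sum_(x <- A) f x.
  exact: ler_sum_fset.
by move=> le2; rewrite ltr_norml; lra.
Qed.


(** Convergence along the net of finite sets, obtained by treating positive and negative parts
    separately, each up to [e / 2]. *)
Lemma rsum_approx f : summ f -> forall e : R, 0 < e ->
  exists A0, forall A, (A0 `<=` A)%fset -> `|\sum_(x <- A) f x - rsum f| < e.
Proof.
move=> sf e e0.
pose p x := Num.max (f x) 0; pose n x := Num.max (- f x) 0.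
have p0 x : 0 <= p x by rewrite le_max lexx orbT.
have n0 x : 0 <= n x by rewrite le_max lexx orbT.
have sN : summ (fun x => `|f x|).
  move: sf => /summP[C fC]; apply/summP; exists C => A.
  by under eq_bigr do rewrite normr_id.
have sp : summ p.
  by apply: summ_le sN => x; rewrite ger0_norm// ge_max ler_norm normr_ge0.
have sn : summ n.
  by apply: summ_le sN => x; rewrite ger0_norm// ge_max -normrN ler_norm normr_ge0.
have rE : rsum f = rsum p - rsum n.
  rewrite (rsum_ge0E p0) (rsum_ge0E n0) /rsum; congr (fine _ - fine _);
    apply: eq_esum => x _.
    by rewrite funeposE /= /p EFin_max.
  by rewrite funenegE /= /n EFin_max.
have e20 : 0 < e / 2 by lra.
have [A1 h1] := rsum_approx_ge0 p0 sp e20.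
have [A2 h2] := rsum_approx_ge0 n0 sn e20.
exists (A1 `|` A2)%fset => A; rewrite fsubUset => /andP[/h1 k1 /h2 k2].
have -> : \sum_(x <- A) f x = \sum_(x <- A) p x - \sum_(x <- A) n x.
  rewrite -sumrB; apply: eq_bigr => x _; rewrite /p /n.
  by case: (leP (f x) 0) => h; case: (leP (- f x) 0) => h'; lra.
by move: k1 k2; rewrite rE !ltr_norml; lra.
Qed.

(** A cluster point of a convergent net is its limit. The set [A] may depend on [e] and need only
    exist beyond each [A0], so special finite sets can be chosen to identify a sum. *)
Lemma rsum_unique f s : summ f ->
  (forall (e : R) A0, 0 < e ->
    exists2 A, (A0 `<=` A)%fset & `|\sum_(x <- A) f x - s| < e) ->
  rsum f = s.
Proof.
move=> sf fs; apply/eqP; rewrite -subr_eq0 -normr_le0 leNgt; apply/negP => d0.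
have d20 : 0 < `|rsum f - s| / 2 by lra.
have [A0 h0] := rsum_approx sf d20.
have [A /h0 h1 h2] := fs _ A0 d20.
have := ler_distD (\sum_(x <- A) f x) (rsum f) s.
by rewrite (distrC (rsum f) (\sum_(x <- A) f x)); lra.
Qed.

Lemma eq_rsum f g : (forall x, f x = g x) -> rsum f = rsum g.
Proof. by move=> /funext->. Qed.

Lemma rsumD f g : summ f -> summ g ->
  rsum (fun x => f x + g x) = rsum f + rsum g.
Proof.
move=> sf sg; apply: rsum_unique => [|e A0 e0]; first exact: summD.
have e20 : 0 < e / 2 by lra.
have [A1 h1] := rsum_approx sf e20.
have [A2 h2] := rsum_approx sg e20.
exists (A0 `|` (A1 `|` A2))%fset; first exact: fsubsetUl.
rewrite big_split/=.
have /h1 : (A1 `<=` A0 `|` (A1 `|` A2))%fset by rewrite fsetUCA fsubsetUl.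
have /h2 : (A2 `<=` A0 `|` (A1 `|` A2))%fset by rewrite fsetUA fsubsetUr.
rewrite !ltr_norml; lra.
Qed.

Lemma rsumZ c f : summ f -> rsum (fun x => c * f x) = c * rsum f.
Proof.
move=> sf; apply: rsum_unique => [|e A0 e0]; first exact: summZ.
have c0 : 0 < `|c| + 1 by have := normr_ge0 c; lra.
have ec0 : 0 < e / (`|c| + 1) by rewrite divr_gt0.
have [A1 h1] := rsum_approx sf ec0.
exists (A0 `|` A1)%fset; first exact: fsubsetUl.
have /h1 : (A1 `<=` A0 `|` A1)%fset by rewrite fsubsetUr.
rewrite -mulr_sumr -mulrBr normrM ltr_pdivlMr// => h.
apply: le_lt_trans h; rewrite mulrC ler_wpM2l//; lra.
Qed.

Lemma rsumN f : summ f -> rsum (fun x => - f x) = - rsum f.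
Proof.
by move=> sf; under eq_rsum do rewrite -mulN1r; rewrite rsumZ// mulN1r.
Qed.

Lemma rsum_ge0 f : (forall x, 0 <= f x) -> 0 <= rsum f.
Proof.
move=> f0; rewrite rsum_ge0E//; apply/fine_ge0/esum_ge0 => x _.
by rewrite lee_fin.
Qed.

Lemma rsum_le f C : summ f -> (forall A, \sum_(x <- A) f x <= C) -> rsum f <= C.
Proof.
move=> sf fC; rewrite leNgt; apply/negP => Cf.
have d0 : 0 < rsum f - C by lra.
have [A0 /(_ A0 (fsubset_refl _))] := rsum_approx sf d0.
by have := fC A0; rewrite ltr_norml; lra.
Qed.

(** The two extended sums in [rsum] are reindexed directly, so no convergence argument enters. *)
Lemma rsum_bij (h : T -> T) f : bijective h -> rsum (f \o h) = rsum f.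
Proof.
move=> bh.
have bT : set_bij [set: T] [set: T] h by rewrite setTT_bijective.
rewrite /rsum; congr (fine _ - fine _); rewrite [RHS](reindex_esum _ _ h _ bT);
  by apply: eq_esum => x _; rewrite ?funeposE ?funenegE.
Qed.

Lemma rsum_fset f A : (forall x, x \notin A -> f x = 0) ->
  summ f /\ rsum f = \sum_(x <- A) f x.
Proof.
move=> f0.
have E B g : (A `<=` B)%fset -> (forall x, x \notin A -> g x = 0) ->
    \sum_(x <- B) g x = \sum_(x <- A) g x :> R.
  move=> AB g0; symmetry; apply: big_fset_incl => // x _ xA.
  exact: g0.
have sf : summ f.
  apply/summP; exists (\sum_(x <- A) `|f x|) => B.
  rewrite -(E (A `|` B)%fset (fun x => `|f x|)) ?fsubsetUl//; last first.
    by move=> x /f0->; exact: normr0.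
  by apply: ler_sum_fset => //; rewrite fsubsetUr.
split=> //; apply: rsum_unique => // e A0 e0.
by exists (A0 `|` A)%fset; rewrite ?fsubsetUl// E ?fsubsetUr// subrr normr0.
Qed.

Lemma rsum_sum (I : Type) (s : seq I) (F : I -> T -> R) : (forall i, summ (F i)) ->
  summ (fun x => \sum_(i <- s) F i x) /\
  rsum (fun x => \sum_(i <- s) F i x) = \sum_(i <- s) rsum (F i).
Proof.
move=> sF; elim: s => [|i s [IH1 IH2]].
  under eq_fun do rewrite big_nil.
  by have := @rsum_fset (fun=> 0) fset0 (fun _ _ => erefl);
    rewrite big_seq_fset0 big_nil.
under eq_fun do rewrite big_cons; rewrite big_cons -IH2 -rsumD//.
by split=> //; exact: summD.
Qed.

End real_sums.

(** * Quaternions and the Hilbert space *)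

Section quaternions.
Context {R : realType}.
Implicit Types x y z : quat R.

Definition nq x : R := q0 x ^+ 2 + q1 x ^+ 2 + q2 x ^+ 2 + q3 x ^+ 2.

Lemma quatP x y : q0 x = q0 y -> q1 x = q1 y -> q2 x = q2 y -> q3 x = q3 y -> x = y.
Proof. by case: x y => a b c d [a' b' c' d'] /= -> -> -> ->. Qed.

Lemma nq_ge0 x : 0 <= nq x.
Proof. by rewrite !addr_ge0// sqr_ge0. Qed.

Lemma absq_sqr x : absq x ^+ 2 = nq x.
Proof. by rewrite sqr_sqrtr// nq_ge0. Qed.

Lemma nq0 : nq (0 : quat R) = 0.
Proof. by rewrite /nq /= expr0n/= !addr0. Qed.

Lemma nq_eq0 x : nq x = 0 -> x = 0.
Proof.
rewrite /nq => /eqP.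
rewrite !paddr_eq0 ?addr_ge0 ?sqr_ge0// !sqrf_eq0 => /andP[/andP[/andP[]]].
by move=> /eqP ? /eqP ? /eqP ? /eqP ?; exact: quatP.
Qed.

Lemma nqM x y : nq (x * y) = nq x * nq y.
Proof. by rewrite /nq /=; ring. Qed.

Lemma nqN x : nq (- x) = nq x.
Proof. by rewrite /nq /= !sqrrN. Qed.

Lemma nq_conj x : nq (conjq x) = nq x.
Proof. by rewrite /nq /= !sqrrN. Qed.

Lemma nqD_le x y : nq (x + y) <= 2 * nq x + 2 * nq y.
Proof. by have := nq_ge0 (x - y); rewrite /nq /=; lra. Qed.

Lemma nqB x y : nq (x - y) = nq x + nq y - 2 * q0 (conjq y * x).
Proof. by rewrite /nq /=; ring. Qed.

Lemma sqr_q0_le x : q0 x ^+ 2 <= nq x.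
Proof. by rewrite /nq -!addrA lerDl !addr_ge0// sqr_ge0. Qed.

Lemma conjqD : {morph @conjq R : x y / x + y}.
Proof. by move=> x y; apply: quatP => //=; rewrite opprD. Qed.

Lemma conjq0 : conjq (0 : quat R) = 0.
Proof. by apply: quatP => //=; rewrite oppr0. Qed.

Lemma conjqM x y : conjq (x * y) = conjq y * conjq x.
Proof. by apply: quatP => /=; ring. Qed.

Lemma conjqK : involutive (@conjq R).
Proof. by move=> x; apply: quatP => //=; rewrite opprK. Qed.

Lemma conjq_sum (I : Type) (s : seq I) (P : pred I) (F : I -> quat R) :
  conjq (\sum_(i <- s | P i) F i) = \sum_(i <- s | P i) conjq (F i).
Proof. by apply: (big_morph _ conjqD conjq0). Qed.

Lemma q0_sum (I : Type) (s : seq I) (P : pred I) (F : I -> quat R) :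
  q0 (\sum_(i <- s | P i) F i) = \sum_(i <- s | P i) q0 (F i).
Proof. by apply: (big_morph (@q0 R)). Qed.

Lemma q0_conjM x : q0 (conjq x * x) = nq x.
Proof. by rewrite /nq /=; ring. Qed.

Lemma rquatD : {morph @rquat R : x y / x + y}.
Proof. by move=> x y; apply: quatP; rewrite /= ?addr0. Qed.

Lemma rquatM : {morph @rquat R : x y / x * y}.
Proof. by move=> x y; apply: quatP => /=; ring. Qed.

Lemma rquat_sum (I : Type) (s : seq I) (P : pred I) (F : I -> R) :
  rquat (\sum_(i <- s | P i) F i) = \sum_(i <- s | P i) rquat (F i).
Proof. by apply: (big_morph _ rquatD). Qed.

Lemma rquat_nat n : rquat n%:R = n%:R :> quat R.
Proof.
by elim: n => // n IH; rewrite -!natr1 rquatD IH.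
Qed.

Lemma rquatC r x : rquat r * x = x * rquat r.
Proof. by apply: quatP => /=; ring. Qed.

Lemma conjq_rquat (r : R) : conjq (rquat r) = rquat r.
Proof. by apply: quatP => //=; rewrite oppr0. Qed.

Lemma nq_rquat (r : R) : nq (rquat r) = r ^+ 2.
Proof. by rewrite /nq /=; ring. Qed.

End quaternions.

(** * Sums of quaternion-valued families *)

Section qsums.
Context {R : realType} {T : choiceType}.
Implicit Types (F G : T -> quat R) (f : T -> R).

Definition qsumm F := [/\ summ (fun k => q0 (F k)), summ (fun k => q1 (F k)),
  summ (fun k => q2 (F k)) & summ (fun k => q3 (F k))].

Lemma qsumD F G : qsumm F -> qsumm G -> qsum (fun k => F k + G k) = qsum F + qsum G.
Proof. by move=> [? ? ? ?] [? ? ? ?]; apply: quatP; rewrite /= -rsumD. Qed.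

Lemma qsum_conj F : qsumm F -> qsum (fun k => conjq (F k)) = conjq (qsum F).
Proof. by move=> [? ? ? ?]; apply: quatP; rewrite /= -?rsumN. Qed.

Lemma eq_qsum F G : (forall k, F k = G k) -> qsum F = qsum G.
Proof. by move=> /funext->. Qed.

(** Each coordinate of [F k * c] is a real linear combination of the four coordinates of [F k], with
    coefficients taken from [c] up to sign; [lin4] sums such a combination. *)
Lemma qsumMr F c : qsumm F -> qsum (fun k => F k * c) = qsum F * c.
Proof.
move=> [s0 s1 s2 s3]; have lin4 (x0 x1 x2 x3 : R) :
    rsum (fun k => x0 * q0 (F k) + x1 * q1 (F k) + x2 * q2 (F k) + x3 * q3 (F k)) =
    x0 * rsum (fun k => q0 (F k)) + x1 * rsum (fun k => q1 (F k)) +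
    x2 * rsum (fun k => q2 (F k)) + x3 * rsum (fun k => q3 (F k)).
  have [z0 z1 z2 z3] := And4 (summZ x0 s0) (summZ x1 s1) (summZ x2 s2) (summZ x3 s3).
  rewrite (rsumD (summD (summD z0 z1) z2) z3) (rsumD (summD z0 z1) z2) (rsumD z0 z1).
  by rewrite !rsumZ.
apply: quatP => /=.
- transitivity (rsum (fun k => q0 c * q0 (F k) + (- q1 c) * q1 (F k) +
    (- q2 c) * q2 (F k) + (- q3 c) * q3 (F k))); first by apply: eq_rsum => k; ring.
  by rewrite lin4//; ring.
- transitivity (rsum (fun k => q1 c * q0 (F k) + q0 c * q1 (F k) +
    q3 c * q2 (F k) + (- q2 c) * q3 (F k))); first by apply: eq_rsum => k; ring.
  by rewrite lin4//; ring.
- transitivity (rsum (fun k => q2 c * q0 (F k) + (- q3 c) * q1 (F k) +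
    q0 c * q2 (F k) + q1 c * q3 (F k))); first by apply: eq_rsum => k; ring.
  by rewrite lin4//; ring.
- transitivity (rsum (fun k => q3 c * q0 (F k) + q2 c * q1 (F k) +
    (- q1 c) * q2 (F k) + q0 c * q3 (F k))); first by apply: eq_rsum => k; ring.
  by rewrite lin4//; ring.
Qed.

Lemma qsum_rquat f : qsum (fun k => rquat (f k)) = rquat (rsum f).
Proof.
have r0 : @rsum R T (fun=> 0) = 0.
  by rewrite (@rsum_fset R T _ fset0 _).2// big_seq_fset0.
by apply: quatP; rewrite /= ?r0.
Qed.

Lemma qsum_fset F (A : {fset T}) : (forall k, k \notin A -> F k = 0) ->
  qsum F = \sum_(k <- A) F k.
Proof.
move=> F0; have E (q : quat R -> R) : {morph q : x y / x + y} -> q 0 = 0 ->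
    rsum (fun k => q (F k)) = q (\sum_(k <- A) F k).
  move=> qD q00; rewrite (big_morph q qD q00).
  by apply: (@rsum_fset _ _ (fun k => q (F k)) A _).2 => k /F0->.
by apply: quatP; rewrite /= E.
Qed.

End qsums.

(** * The right Hilbert space of square-summable functions *)

Section l2_theory.
Context {R : realType}.
Implicit Types f g h : Z2 -> quat R.

Definition sqn f : R := rsum (fun k => nq (f k)).

Lemma l2E f : l2 f <-> summ (fun k => nq (f k)).
Proof. by rewrite /l2; under eq_fun do rewrite absq_sqr. Qed.

Lemma l2D f g : l2 f -> l2 g -> l2 (fun k => f k + g k).
Proof.
move=> /l2E sf /l2E sg; apply/l2E.
apply: (summ_le _ (summD (summZ 2 sf) (summZ 2 sg))) => k.
by rewrite ger0_norm ?nq_ge0// nqD_le.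
Qed.

Lemma l2N f : l2 f -> l2 (fun k => - f k).
Proof. by rewrite !l2E; under [in X in _ -> X]eq_fun do rewrite nqN. Qed.

Lemma l2Mr f c : l2 f -> l2 (fun k => f k * c).
Proof.
move=> /l2E sf; apply/l2E; apply: (summ_le _ (summZ (nq c) sf)) => k.
by rewrite ger0_norm ?nq_ge0// nqM mulrC.
Qed.

Lemma l2_0 : l2 (fun=> 0 : quat R).
Proof.
apply/l2E; apply: (@rsum_fset _ _ _ fset0 _).1 => k _.
exact: nq0.
Qed.

Lemma l2_right_comb (I : Type) (u : I -> Z2 -> quat R) s c :
  (forall a, l2 (u a)) -> l2 (right_comb u s c).
Proof.
move=> ul2; elim: s => [|a s IH].
  by rewrite /right_comb; under eq_fun do rewrite big_nil; exact: l2_0.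
rewrite /right_comb; under eq_fun do rewrite big_cons.
by apply: l2D => //; apply: l2Mr.
Qed.

Lemma l2_fset f (A : {fset Z2}) : (forall k, k \notin A -> f k = 0) -> l2 f.
Proof.
move=> f0; apply/l2E; apply: (@rsum_fset _ _ _ A _).1 => k /f0->.
exact: nq0.
Qed.

Lemma qsumm_inner f g : l2 f -> l2 g -> qsumm (fun k => conjq (f k) * g k).
Proof.
move=> /l2E sf /l2E sg; have sfg := summD sf sg.
(* Here x^2 <= nq (f k) nq (g k) <= (nq (f k) + nq (g k))^2, so every coordinate of the product is
   dominated by one summable family. *)
have E k (x : R) : x ^+ 2 <= nq (conjq (f k) * g k) -> `|x| <= nq (f k) + nq (g k).
  rewrite nqM nq_conj => h; have ? := nq_ge0 (f k); have ? := nq_ge0 (g k).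
  by rewrite ler_norml; apply/andP; split; nra.
split; apply: summ_le sfg => k; apply: E; set z := (_ * _);
  have := sqr_ge0 (q0 z); have := sqr_ge0 (q1 z);
  have := sqr_ge0 (q2 z); have := sqr_ge0 (q3 z); rewrite /nq; lra.
Qed.

Lemma l2_innerDr f g h : l2 f -> l2 g -> l2 h ->
  l2_inner f (fun k => g k + h k) = l2_inner f g + l2_inner f h.
Proof.
move=> lf lg lh; rewrite /l2_inner -qsumD; [|exact: qsumm_inner..].
by apply: eq_qsum => k; rewrite mulrDr.
Qed.

Lemma l2_innerMr f g c : l2 f -> l2 g ->
  l2_inner f (fun k => g k * c) = l2_inner f g * c.
Proof.
move=> lf lg; rewrite /l2_inner -qsumMr; last exact: qsumm_inner.
by apply: eq_qsum => k; rewrite mulrA.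
Qed.

Lemma l2_inner_conj f g : l2 f -> l2 g -> conjq (l2_inner f g) = l2_inner g f.
Proof.
move=> lf lg; rewrite /l2_inner -qsum_conj; last exact: qsumm_inner.
by apply: eq_qsum => k; rewrite conjqM conjqK.
Qed.

Lemma l2_inner_fset f g (A : {fset Z2}) : (forall k, k \notin A -> g k = 0) ->
  l2_inner f g = \sum_(k <- A) conjq (f k) * g k.
Proof. by move=> g0; apply: qsum_fset => k /g0->; rewrite mulr0. Qed.

Lemma l2_inner_comb (I : Type) (u : I -> Z2 -> quat R) s c f :
  (forall a, l2 (u a)) -> l2 f ->
  l2_inner f (right_comb u s c) = \sum_(a <- s) l2_inner f (u a) * c a.
Proof.
move=> ul2 lf; elim: s => [|a s IH].
  rewrite big_nil (@l2_inner_fset _ _ fset0) ?big_nil// => k _.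
  by rewrite /right_comb big_nil.
rewrite big_cons -IH -l2_innerMr// -l2_innerDr//; [|exact: l2Mr|exact: l2_right_comb].
by congr l2_inner; apply/funext => k; rewrite /right_comb big_cons.
Qed.

Lemma l2_inner_self f : q0 (l2_inner f f) = sqn f.
Proof. by apply: eq_rsum => k; rewrite q0_conjM. Qed.

Lemma sqn_ge0 f : 0 <= sqn f.
Proof. by apply: rsum_ge0 => k; exact: nq_ge0. Qed.

Lemma l2_norm_lt f e : 0 < e -> (l2_norm f < e) = (sqn f < e ^+ 2).
Proof.
move=> e0; rewrite /l2_norm l2_inner_self -[X in _ < X]gtr0_norm// -sqrtr_sqr.
by rewrite ltr_sqrt// exprn_gt0.
Qed.

Lemma sqnB f g : l2 f -> l2 g ->
  sqn (fun k => f k - g k) = sqn f + sqn g - 2 * q0 (l2_inner g f).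
Proof.
move=> lf lg; have [s0 _ _ _] := qsumm_inner lg lf.
move: lf lg => /l2E sf /l2E sg.
rewrite /sqn /l2_inner /= -(rsumZ 2 s0) -(rsumD sf sg) -(rsumN (summZ 2 s0)).
rewrite -(rsumD (summD sf sg) (summN (summZ 2 s0))).
by apply: eq_rsum => k; rewrite nqB.
Qed.

(** Stands in for the triangle inequality: the factor 2 is harmless in approximation arguments and
    keeps square roots out. *)
Lemma sqnD_le f g : l2 f -> l2 g ->
  sqn (fun k => f k + g k) <= 2 * sqn f + 2 * sqn g.
Proof.
move=> lf lg; have /l2E s := l2D lf lg; rewrite {1}/sqn; apply: (rsum_le s) => A.
move: lf lg => /l2E sf /l2E sg.
apply: (@le_trans _ _ (\sum_(k <- A) (2 * nq (f k) + 2 * nq (g k)))).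
  by apply: ler_sum => k _; exact: nqD_le.
rewrite big_split/= -!mulr_sumr lerD// ler_wpM2l// rsum_fset_le// => k;
  exact: nq_ge0.
Qed.

Lemma nq_le_sqn f k : l2 f -> nq (f k) <= sqn f.
Proof.
move=> /l2E sf; have := rsum_fset_le [fset k]%fset (fun k => nq_ge0 (f k)) sf.
by rewrite big_seq_fset1.
Qed.

End l2_theory.

(** * Orthonormal bases and the resolution of the identity *)

Section expansions.
Context {R : realType} {I : choiceType} (u : I -> Z2 -> quat R).
Implicit Types (A t : {fset I}) (S : {fset Z2}) (f : Z2 -> quat R).

(** The matrix of the right-linear operator that sends f to the sum of u_a <u_a, f> over [t]; as
    scalars act on the right, the conjugate is the right factor. *)
Definition kernel t (k k' : Z2) : quat R := \sum_(a <- t) u a k * conjq (u a k').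

(* [sum_a u_a u_a^* = 1], the sum being taken in the sense that the identity
   matrix is approximated on every finite block [S] by the kernels of arbitrarily
   large finite sets [t].  The kernels are required to be real, as those of the
   Gabor system are. *)
Definition resolves_identity := forall A S (e : R), 0 < e ->
  exists2 t, (A `<=` t)%fset & forall k k', k \in S -> k' \in S ->
    kernel t k k' = rquat (q0 (kernel t k k')) /\
    `|q0 (kernel t k k') - (k == k')%:R| < e.

Definition point_mass (k : Z2) : Z2 -> quat R := fun k' => (k' == k)%:R.

Lemma l2_point_mass k : l2 (point_mass k).
Proof.
by apply: (@l2_fset _ _ [fset k]%fset) => k'; rewrite inE /point_mass => /negPf->.
Qed.

Lemma l2_inner_point_mass f k : l2_inner f (point_mass k) = conjq (f k).
Proof.
rewrite (@l2_inner_fset _ _ _ [fset k]%fset) => [|k']; last first.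
  by rewrite inE /point_mass => /negPf->.
by rewrite big_seq_fset1 /point_mass eqxx mulr1.
Qed.

Hypothesis ul2 : forall a, l2 (u a).

Lemma l2_comb_inner (s : seq I) c f : l2 f ->
  l2_inner (right_comb u s c) f = \sum_(a <- s) conjq (c a) * l2_inner (u a) f.
Proof.
move=> lf; rewrite -l2_inner_conj//; last exact: l2_right_comb.
rewrite l2_inner_comb// conjq_sum; apply: eq_bigr => a _.
by rewrite conjqM l2_inner_conj.
Qed.

(** Density provides a list in which indices may repeat. Coefficients of equal indices are added up,
    and an index of [t] outside [s] gets the empty sum 0. *)
Lemma right_comb_fset (s : seq I) c t : {subset s <= t} ->
  right_comb u s c = right_comb u t (fun a => \sum_(b <- s | b == a) c b).
Proof.
move=> st; apply/funext => k; rewrite /right_comb.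
under [RHS]eq_bigr do rewrite mulr_sumr.
rewrite (exchange_big_dep xpredT)// big_seq [RHS]big_seq.
apply: eq_bigr => b /st bt; rewrite -big_filter.
rewrite (_ : [seq i <- t | b == i] = [:: b]) ?big_seq1//.
rewrite (eq_filter (a2 := pred1 b)) => [|i]; last exact: eq_sym.
by rewrite filter_pred1_uniq.
Qed.

Section orthonormal.
Hypothesis uorth : forall a b, l2_inner (u a) (u b) = (a == b)%:R.

(** Completing the square in each coefficient: the last sum is the excess over the best
    approximation, whose coefficients are <u_a, f>. *)
Lemma sqn_sub_comb t c f : l2 f ->
  sqn (fun k => f k - right_comb u t c k) =
  sqn f - \sum_(a <- t) nq (l2_inner (u a) f)
  + \sum_(a <- t) nq (c a - l2_inner (u a) f).
Proof.
move=> lf; have lc := l2_right_comb t c ul2.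
rewrite sqnB// -(l2_inner_self (right_comb u t c)) !l2_comb_inner// !q0_sum.
have -> : \sum_(a <- t) q0 (conjq (c a) * l2_inner (u a) (right_comb u t c)) =
          \sum_(a <- t) nq (c a).
  rewrite big_seq [RHS]big_seq; apply: eq_bigr => a ta.
  rewrite l2_inner_comb// (bigD1_seq a)// uorth eqxx mul1r.
  rewrite big1 => [|b ba]; last by rewrite uorth eq_sym (negPf ba) mul0r.
  by rewrite [X in conjq _ * X]addr0 q0_conjM.
move: (sqn f) => F; rewrite mulr_sumr -!addrA; congr (_ + _).
rewrite -!sumrN -!big_split/=; apply: eq_bigr => a _.
by rewrite /nq /=; ring.
Qed.

End orthonormal.

(* The comb with coefficients [<u_a, delta_k>] is the best approximation of
   [delta_k] from the span of [t], so it does at least as well as any comb given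
   by density; its value at [k'] is [kernel t k' k]. *)
Lemma kernel_cvg : orthonormal_basis u ->
  forall k (e : R), 0 < e -> exists s : {fset I}, forall t, (s `<=` t)%fset ->
    forall k', `|q0 (kernel t k' k) - (k' == k)%:R| < e.
Proof.
move=> [_ uorth udense] k e e0.
have [s [c]] := udense _ (l2_point_mass k) e e0.
rewrite l2_norm_lt// => lt; exists [fset a in s]%fset => t st k'.
have {}st : {subset s <= t}.
  by move=> a sa; apply: (fsubsetP st); rewrite inE.
move: lt; rewrite (right_comb_fset _ st) sqn_sub_comb//; last exact: l2_point_mass.
set c' := fun _ => _ => lt.
set r := fun k' => point_mass k k' - right_comb u t (fun a => conjq (u a k)) k'.
have lr : l2 r by apply: l2D; [exact: l2_point_mass|apply/l2N/l2_right_comb].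
have : sqn r < e ^+ 2.
  apply: le_lt_trans lt; rewrite sqn_sub_comb//; last exact: l2_point_mass.
  rewrite lerD2l; apply: (@le_trans _ _ 0); last first.
    by rewrite sumr_ge0// => a _; exact: nq_ge0.
  rewrite big1// => a _; by rewrite l2_inner_point_mass subrr nq0.
(* One value of the residual is dominated by its norm, which makes the bound uniform in [k']. *)
have := le_trans (sqr_q0_le _) (nq_le_sqn k' lr).
have -> : q0 (r k') = (k' == k)%:R - q0 (kernel t k' k).
  by rewrite /r /kernel /right_comb /= /point_mass; case: (k' == k).
by move=> h1 h2; rewrite ltr_norml; apply/andP; split; nra.
Qed.

(** * From a resolution of the identity to an orthonormal basis *)

Section resolution.
Hypothesis ures : resolves_identity.

(** The sum over [t] is the quadratic form of [kernel t] at the restriction of [v] to [S], and the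
    kernel is close to the identity matrix on [S]. *)
Lemma parseval_approx A S (v : Z2 -> quat R) (e : R) : 0 < e ->
  exists2 t, (A `<=` t)%fset &
    `|\sum_(a <- t) nq (\sum_(k <- S) conjq (u a k) * v k) -
      \sum_(k <- S) nq (v k)| < e.
Proof.
move=> e0; pose w k k' := q0 (conjq (v k) * v k').
(* An entrywise error d in the kernel changes the form by at most d [W]; dividing by [W + 1] also
   covers [W] = 0. *)
pose W := \sum_(k <- S) \sum_(k' <- S) `|w k k'|.
have W0 : 0 <= W by do 2!apply: sumr_ge0 => ? _.
have eW0 : 0 < e / (W + 1) by rewrite divr_gt0//; lra.
have [t At ht] := ures A S eW0; exists t => //.
have -> : \sum_(a <- t) nq (\sum_(k <- S) conjq (u a k) * v k) =
    \sum_(k <- S) \sum_(k' <- S) q0 (kernel t k k') * w k k'.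
  transitivity (q0 (\sum_(a <- t) \sum_(k <- S) \sum_(k' <- S)
      conjq (v k) * (u a k * conjq (u a k')) * v k')).
    rewrite q0_sum; apply: eq_bigr => a _; rewrite -q0_conjM; congr q0.
    rewrite conjq_sum mulr_suml; apply: eq_bigr => k _.
    rewrite mulr_sumr; apply: eq_bigr => k' _.
    by rewrite conjqM conjqK !mulrA.
  rewrite exchange_big/= q0_sum big_seq [RHS]big_seq; apply: eq_bigr => k Sk.
  rewrite exchange_big/= q0_sum big_seq [RHS]big_seq; apply: eq_bigr => k' Sk'.
  (* The kernel stands between [conjq (v k)] and [v k']; being real, it moves out in front. *)
  rewrite -mulr_suml -mulr_sumr -/(kernel t k k') (ht _ _ Sk Sk').1 -rquatC -mulrA.
  by rewrite /w /=; ring.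
have -> : \sum_(k <- S) nq (v k) =
    \sum_(k <- S) \sum_(k' <- S) (k == k')%:R * w k k'.
  rewrite big_seq [RHS]big_seq; apply: eq_bigr => k Sk.
  rewrite (bigD1_seq k)//= eqxx mul1r big1 ?addr0 /w ?q0_conjM// => k' kk'.
  by rewrite eq_sym (negPf kk') mul0r.
rewrite -sumrB; apply: (@le_lt_trans _ _ (e / (W + 1) * W)); last first.
  by rewrite -mulrA gtr_pMr// mulrC ltr_pdivrMr; lra.
apply: le_trans (ler_norm_sum _ _ _) _; rewrite /W mulr_sumr big_seq [leRHS]big_seq.
apply: ler_sum => k Sk; rewrite -sumrB.
apply: le_trans (ler_norm_sum _ _ _) _; rewrite mulr_sumr big_seq [leRHS]big_seq.
apply: ler_sum => k' Sk'; rewrite -mulrBl normrM ler_wpM2r//.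
exact/ltW/(ht _ _ Sk Sk').2.
Qed.

(** An excess at [A] would persist for every larger [t], since the terms are nonnegative; taking
    that excess as the tolerance in [parseval_approx] is contradictory. *)
Lemma bessel_fset A S (v : Z2 -> quat R) :
  \sum_(a <- A) nq (\sum_(k <- S) conjq (u a k) * v k) <= \sum_(k <- S) nq (v k).
Proof.
rewrite leNgt; apply/negP; rewrite -subr_gt0 => /(parseval_approx A S v)[t At].
have := ler_sum_fset (fun a => nq_ge0 (\sum_(k <- S) conjq (u a k) * v k)) At.
by rewrite ltr_norml; lra.
Qed.

(* Dual to [bessel_fset]: the finite matrix [(u_a(k))_(k in S, a in A)] and its
   adjoint have the same norm, which is at most 1. *)
Lemma sqn_comb_le A c : sqn (right_comb u A c) <= \sum_(a <- A) nq (c a).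
Proof.
have /l2E sc := l2_right_comb A c ul2; rewrite /sqn; apply: (rsum_le sc) => S.
set v := right_comb u A c; set d := fun a => \sum_(k <- S) conjq (u a k) * v k.
have h1 : \sum_(a <- A) nq (d a) <= \sum_(k <- S) nq (v k) by exact: bessel_fset.
have h2 : \sum_(k <- S) nq (v k) = \sum_(a <- A) q0 (conjq (c a) * d a).
  rewrite -q0_sum; under [in RHS]eq_bigr do rewrite mulr_sumr.
  rewrite exchange_big/= q0_sum; apply: eq_bigr => k _; rewrite -q0_conjM; congr q0.
  rewrite {1}/v /right_comb conjq_sum mulr_suml; apply: eq_bigr => a _.
  by rewrite conjqM mulrA.
(* Let V be the sum of [nq (v k)] over [S] and C that of [nq (c a)] over [A]. Expanding and using
   [h1] and [h2] gives 0 <= V + C - 2V, that is V <= C. *)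
have : 0 <= \sum_(a <- A) nq (d a - c a) by rewrite sumr_ge0// => a _; exact: nq_ge0.
under eq_bigr do rewrite nqB.
by rewrite sumrB big_split/= -mulr_sumr -h2; lra.
Qed.

(** Expand 0 <= |f - sum_a u_a c_a|^2 with c_a = <u_a, f>: the cross term is -2 sum |c_a|^2, and
    [sqn_comb_le] bounds the square of the combination by sum |c_a|^2. *)
Lemma bessel A f : l2 f -> \sum_(a <- A) nq (l2_inner (u a) f) <= sqn f.
Proof.
move=> lf; set c := fun a => l2_inner (u a) f.
have := sqn_ge0 (fun k => f k - right_comb u A c k).
rewrite sqnB//; last exact: l2_right_comb.
rewrite l2_comb_inner// q0_sum (eq_bigr _ (fun a _ => q0_conjM (c a))).
have := sqn_comb_le A c; rewrite -/(c _); lra.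
Qed.

(** Bessel's inequality for f = u_a, with only the index [a] kept, reads |u_a|^4 <= |u_a|^2. *)
Lemma sqn_le1 a : sqn (u a) <= 1.
Proof.
have := bessel [fset a]%fset (ul2 a); rewrite big_seq_fset1 => h.
have := sqr_q0_le (l2_inner (u a) (u a)); rewrite l2_inner_self => h'.
by rewrite leNgt; apply/negP => h1; nra.
Qed.

Hypothesis u1 : forall a, sqn (u a) = 1.

Lemma orthonormal_resolution a b : l2_inner (u a) (u b) = (a == b)%:R.
Proof.
(* The real part of <u_c, u_c> is 1, and Bessel's inequality bounds its squared modulus by 1, which
   leaves no room for imaginary coordinates. *)
have I1 c : l2_inner (u c) (u c) = 1.
  apply/eqP; rewrite -subr_eq0; apply/eqP/nq_eq0/eqP; rewrite eq_le nq_ge0 andbT.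
  have := bessel [fset c]%fset (ul2 c); rewrite big_seq_fset1.
  have := l2_inner_self (u c); rewrite !u1 /nq /=; nra.
have [->|ab] := eqVneq a b; first exact: I1.
apply/nq_eq0/eqP; rewrite eq_le nq_ge0 andbT.
have := bessel (a |` [fset b])%fset (ul2 b).
rewrite big_fsetU1 ?inE//= big_seq_fset1 I1 u1 /nq /=; lra.
Qed.

Lemma resolution_orthonormal_basis : orthonormal_basis u.
Proof.
split=> [//||f lf e e0]; first exact: orthonormal_resolution.
(* Two errors below [e ^+ 2 / 4], truncation to [S] and projection to the span of [t], are each
   doubled by [sqnD_le]. *)
have e20 : 0 < e ^+ 2 / 4 by rewrite divr_gt0// exprn_gt0.
have [S /(_ S (fsubset_refl _)) hS] := rsum_approx ((l2E f).1 lf) e20.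
pose fS k := if k \in S then f k else 0.
have fS0 k : k \notin S -> fS k = 0 by rewrite /fS => /negPf->.
have lS : l2 fS by exact: l2_fset fS0.
have sqS : sqn fS = \sum_(k <- S) nq (fS k).
  by apply: (@rsum_fset _ _ (fun k => nq (fS k)) S _).2 => k /fS0->; rewrite nq0.
have hfS : sqn (fun k => f k - fS k) < e ^+ 2 / 4.
  (* The truncation and the remainder have disjoint supports. *)
  have -> : sqn (fun k => f k - fS k) = sqn f - sqn fS.
    move: (lf) (lS) => /l2E sf /l2E sS.
    rewrite /sqn -(rsumN sS) -(rsumD sf (summN sS)); apply: eq_rsum => k.
    by rewrite /fS; case: ifP => _; rewrite ?subr0 ?subrr ?nq0 ?subr0.
  have -> : sqn fS = \sum_(k <- S) nq (f k).
    by rewrite sqS big_seq [RHS]big_seq; apply: eq_bigr => k kS; rewrite /fS kS.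
  by move: hS; rewrite -/(sqn f) ltr_norml; lra.
have [t _ ht] := parseval_approx fset0 S fS e20.
pose c a := l2_inner (u a) fS; exists t, c.
have hc : sqn (fun k => fS k - right_comb u t c k) < e ^+ 2 / 4.
  (* Orthonormality makes the projection error exactly |fS|^2 - sum |c_a|^2, the defect controlled
     by [ht]. *)
  rewrite (sqn_sub_comb orthonormal_resolution)// [X in _ + X]big1 => [|a _]; last first.
    by rewrite subrr nq0.
  move: ht; rewrite -sqS (eq_bigr (fun a => nq (c a))) => [|a _]; last first.
    by rewrite /c (l2_inner_fset _ fS0).
  by rewrite /c ltr_norml; lra.
rewrite l2_norm_lt//.
rewrite (_ : (fun _ => _) =
    fun k => (f k - fS k) + (fS k - right_comb u t c k)); last first.
  by apply/funext => k; rewrite subrKA.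
apply: le_lt_trans (sqnD_le _ _) _; last by lra.
  by apply: l2D => //; exact: l2N.
by apply: l2D => //; apply/l2N/l2_right_comb.
Qed.

End resolution.
End expansions.

(** * Characters and the Gabor kernel *)

Lemma rquatCA {R : realType} (r : R) (x y : quat R) :
  x * (rquat r * y) = rquat r * (x * y).
Proof. by rewrite mulrA -rquatC mulrA. Qed.

(** Real factors are central and leave the product, so that [b] and [conjq b'] become neighbours in
    the middle. *)
Lemma mul_conjq_rquat {R : realType} (a b a' b' : quat R) (r r' : R) :
  (a * rquat r * b) * conjq (a' * rquat r' * b') =
  rquat (r * r') * (a * (b * conjq b') * conjq a').
Proof.
rewrite !conjqM conjq_rquat rquatM -!mulrA.
by rewrite (rquatCA r' (conjq b')) (rquatCA _ b) !(rquatCA _ a).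
Qed.

Section characters.
Context {R : realType} (u : quat R).
Hypothesis hu : u = iq R \/ u = jq R.
Implicit Types s t : R.

Lemma expq0 : expq u 0 = 1.
Proof. by rewrite /expq cos0 sin0; apply: quatP; case: hu => -> /=; ring. Qed.

Lemma expqD s t : expq u (s + t) = expq u s * expq u t.
Proof. by rewrite /expq cosD sinD; apply: quatP; case: hu => -> /=; ring. Qed.

Lemma conjq_expq t : conjq (expq u t) = expq u (- t).
Proof. by rewrite /expq cosN sinN; apply: quatP; case: hu => -> /=; ring. Qed.

Lemma q0_expq t : q0 (expq u t) = cos t.
Proof. by rewrite /expq; case: hu => -> /=; ring. Qed.

Lemma nq_expq t : nq (expq u t) = 1.
Proof. by rewrite -(cos2Dsin2 t) /nq /expq; case: hu => -> /=; ring. Qed.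

Lemma expqMn t n : expq u (t * n%:R) = expq u t ^+ n.
Proof.
elim: n => [|n IH]; first by rewrite mulr0 expq0.
by rewrite -natr1 mulrDr mulr1 expqD IH exprSr.
Qed.

Lemma expq_2piMz (d : int) : expq u (2 * pi * d%:~R) = 1.
Proof.
have E1 : expq u (2 * pi) = 1.
  have -> : 2 * pi = pi *+ 2 :> R by rewrite mulr_natl.
  by rewrite /expq cos2pi sin2pi; apply: quatP; case: hu => -> /=; ring.
have En n : expq u (2 * pi * n%:R) = 1 by rewrite expqMn E1 expr1n.
case: d => n; first exact: En.
by rewrite NegzE mulrNz mulrN -conjq_expq En; apply: quatP => //=; rewrite oppr0.
Qed.

(** Reduction modulo [M] leaves a remainder r with cos(2 pi r / M) = 1, hence sin(pi r / M) = 0 by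
    the double angle formula; as 0 <= pi r / M < pi, this forces r = 0. *)
Lemma expq_eq1_dvd (M : nat) (d : int) : (0 < M)%N ->
  expq u (2 * pi * (d%:~R / M%:R)) = 1 <-> (M %| d)%Z.
Proof.
move=> M0; have M0' : M%:R != 0 :> R by rewrite pnatr_eq0 -lt0n.
have Mp : 0 < M%:R :> R by rewrite ltr0n.
split=> [|/dvdzP[q ->]]; last first.
  by rewrite intrM -pmulrn mulfK// expq_2piMz.
have -> : d%:~R / M%:R = (d %/ M)%Z%:~R + (d %% M)%Z%:~R / M%:R :> R.
  by rewrite {1}(divz_eq d M) intrD intrM mulrDl -(pmulrn 1 M) mulfK.
rewrite mulrDr expqD expq_2piMz mul1r.
move=> /(congr1 (@q0 R)); rewrite q0_expq.
have r0 : 0 <= (d %% M)%Z by rewrite modz_ge0// -lt0n.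
have rM : (d %% M)%Z < M by rewrite ltz_pmod.
case E : (d %% M)%Z r0 rM => [r|//] _; rewrite ltz_nat => rM.
have -> : 2 * pi * (r%:~R / M%:R) = (pi * (r%:R / M%:R)) *+ 2 :> R.
  by rewrite -pmulrn mulr_natl mulrnAl.
rewrite cos_mulr2n cos2sin2 /= => h.
have {h} s0 : sin (pi * (r%:R / M%:R)) = 0 :> R.
  by apply/eqP; rewrite -sqrf_eq0; apply/eqP; move: h; rewrite -mulr_natl; lra.
case: (posnP r) => [r00|r0]; first by apply/dvdz_mod0P; rewrite E r00.
have : 0 < sin (pi * (r%:R / M%:R)) :> R.
  apply: sin_gt0_pi; rewrite mulr_gt0 ?pi_gt0 ?divr_gt0 ?ltr0n//=.
  by rewrite gtr_pMr ?pi_gt0// ltr_pdivrMr// mul1r ltr_nat.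
by rewrite s0 ltxx.
Qed.

(* For [z^M = 1] we have [(z - 1) (1 + z + ... + z^(M-1)) = 0]. *)
Lemma expq_sum (M : nat) (d : int) : (0 < M)%N ->
  \sum_(m < M) expq u (2 * pi * (m%:R / M%:R) * d%:~R) =
  rquat (M%:R * (M %| d)%Z%:R).
Proof.
move=> M0; set z := expq u (2 * pi * (d%:~R / M%:R)).
have M0' : M%:R != 0 :> R by rewrite pnatr_eq0 -lt0n.
have -> : \sum_(m < M) expq u (2 * pi * (m%:R / M%:R) * d%:~R) = \sum_(m < M) z ^+ m.
  by apply: eq_bigr => m _; rewrite /z -expqMn; congr expq; ring.
have zM : z ^+ M = 1 by rewrite /z -expqMn -!mulrA mulVf// mulr1 mulrA expq_2piMz.
have [/(expq_eq1_dvd _ M0).2|ndvd] := boolP (M %| d)%Z.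
  rewrite -/z => ->; under eq_bigr do rewrite expr1n.
  by rewrite sumr_const card_ord mulr1 rquat_nat.
rewrite mulr0; apply: nq_eq0; apply/eqP.
(* Multiplicativity of [nq] excludes zero divisors among quaternions. *)
have : nq (z - 1) * nq (\sum_(m < M) z ^+ m) = 0 by rewrite -nqM -subrX1 zM subrr nq0.
move/eqP; rewrite mulf_eq0 => /orP[/eqP/nq_eq0/eqP|//].
by rewrite subr_eq0 => /eqP /(expq_eq1_dvd _ M0).1; rewrite (negPf ndvd).
Qed.

End characters.

(** * Kernels of the Gabor system and autocorrelations of the windows *)

Section gabor_kernel.
Context {R : realType} (L M N : nat) (g : 'I_L -> Z2 -> quat R).
Hypotheses (M0 : (0 < M)%N) (N0 : (0 < N)%N).
Hypothesis hg : forall l, l2 (g l) /\ real_valued (g l).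

Local Notation J := ('I_L * ('I_M * 'I_M))%type.
Local Notation G l k := (q0 (g l k)).

Definition dvdM (d : Z2) := (M %| d.1)%Z && (M %| d.2)%Z.

(** Only translations are restricted, so the character sums over m are complete; every finite set of
    indices lies in such a set. *)
Definition index_set (B : {fset Z2}) : {fset J * Z2} :=
  seq_fset tt [seq (x, n) | x <- enum {: J}, n <- B].

Lemma in_index_set B (x : J * Z2) : (x \in index_set B) = (x.2 \in B).
Proof.
rewrite seq_fsetE; case: x => x n; apply/allpairsP/idP => /=.
  by move=> [[y m] [_ mB [_ ->]]].
by move=> nB; exists (x, n); split; rewrite ?mem_enum.
Qed.

Lemma gE l k : g l k = rquat (G l k).
Proof. by have [r ->] := (hg l).2 k. Qed.

(** Retains only the character laws needed for the kernel, in one form that serves both units. *)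
Lemma character_spec (u : quat R) : u = iq R \/ u = jq R ->
  exists e : 'I_M -> int -> quat R,
  [/\ forall m c d, e m (c + d) = e m c * e m d,
      forall m c, conjq (e m c) = e m (- c),
      forall d, \sum_m e m d = rquat (M%:R * (M %| d)%Z%:R)
    & forall (m : 'I_M) c, expq u (2 * pi * (m%:R / M%:R) * c%:~R) = e m c].
Proof.
move=> hu; exists (fun m c => expq u (2 * pi * (m%:R / M%:R) * c%:~R)).
split=> [m c d|m c|d|//]; last exact: expq_sum.
- by rewrite intrD mulrDr expqD.
- by rewrite conjq_expq// mulrNz mulrN.
Qed.

(* The sum over [m.2] of [e^(2 pi j m.2 (k.2 - k'.2) / M)] sits in the middle and
   is real; only after it is moved out can the two outer [i]-exponentials meet. *)
Lemma gabor_block k k' n :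
  \sum_(x : J) gabor_system M N g (x, n) k * conjq (gabor_system M N g (x, n) k') =
  rquat (M%:R ^+ 2 * (dvdM (k - k'))%:R *
    \sum_(l < L) G l (k - n *+ N) * G l (k' - n *+ N)).
Proof.
have hi : iq R = iq R \/ iq R = jq R by left.
have hj : jq R = iq R \/ jq R = jq R by right.
transitivity (\sum_(l < L) \sum_m gabor_system M N g (l, m, n) k *
    conjq (gabor_system M N g (l, m, n) k')).
  by rewrite pair_big/=; apply: eq_bigr => -[l m] _.
rewrite mulr_sumr rquat_sum; apply: eq_bigr => l _.
set w := G l (k - n *+ N) * G l (k' - n *+ N).
have [e1 [e1D e1N e1S e1E]] := character_spec hi.
have [e2 [e2D e2N e2S e2E]] := character_spec hj.
have E m1 m2 c : modulation (m1, m2) (translation (n *+ N) (g l)) c =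
    e1 m1 c.1 * rquat (G l (c - n *+ N)) * e2 m2 c.2.
  by rewrite -gE -e1E -e2E.
transitivity (\sum_(m1 < M) \sum_(m2 < M)
    rquat w * (e1 m1 k.1 * e2 m2 (k.2 - k'.2) * e1 m1 (- k'.1))).
  rewrite pair_big/=; apply: eq_bigr => -[m1 m2] _.
  by rewrite /= !E mul_conjq_rquat e1N e2N e2D.
under eq_bigr do rewrite -mulr_sumr -mulr_suml -mulr_sumr e2S.
pose s2 : R := M%:R * (M %| k.2 - k'.2)%Z%:R.
rewrite -mulr_sumr (eq_bigr (fun m1 => rquat s2 * e1 m1 (k.1 - k'.1))); last first.
  move=> m1 _.
  by rewrite e1D -mulrA rquatCA.
rewrite -mulr_sumr e1S -!rquatM; congr rquat.
by rewrite /s2 /dvdM /=; case: (M %| k.1 - k'.1)%Z; case: (M %| k.2 - k'.2)%Z => /=; ring.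
Qed.

Lemma kernel_index_set B k k' :
  kernel (gabor_system M N g) (index_set B) k k' =
  rquat (M%:R ^+ 2 * (dvdM (k - k'))%:R *
    \sum_(n <- B) \sum_(l < L) G l (k - n *+ N) * G l (k' - n *+ N)).
Proof.
rewrite /kernel (perm_big _ (seq_fset_perm _ _))/= undup_id; last first.
  by apply: allpairs_uniq; rewrite ?enum_uniq ?fset_uniq// => -[x n] [y m].
rewrite big_allpairs exchange_big mulr_sumr rquat_sum; apply: eq_bigr => n _.
by rewrite -gabor_block big_enum.
Qed.

(** For k' = k + pM this is the n-th term of the (0, p) entry in condition (b). *)
Definition autocorr (k k' n : Z2) : R :=
  \sum_(l < L) G l (k - n *+ N) * G l (k' - n *+ N).

Lemma mulrnI_Z2 K : (0 < K)%N -> injective (fun n : Z2 => n *+ K).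
Proof.
case: K => // K _ [a b] [c d] h.
have := congr1 fst h; have := congr1 snd h; rewrite /= !(raddfMn fst, raddfMn snd)/=.
by move=> /eqP + /eqP; rewrite !eqr_pMn2r// => /eqP-> /eqP->.
Qed.

Lemma summ_shift (f : Z2 -> R) k : summ f -> summ (fun n => f (k - n *+ N)).
Proof.
apply: (@summ_inj _ _ (fun n : Z2 => k - n *+ N)) => x y /addrI /oppr_inj.
exact: mulrnI_Z2.
Qed.

Lemma summ_sqr l : summ (fun k => G l k ^+ 2).
Proof.
have [/l2E sl _] := hg l; apply: summ_le sl => k.
by rewrite ger0_norm ?sqr_ge0// sqr_q0_le.
Qed.

Lemma summ_shiftM l k k' : summ (fun n => G l (k - n *+ N) * G l (k' - n *+ N)).
Proof.
apply: summ_le (summD (summ_shift k (summ_sqr l)) (summ_shift k' (summ_sqr l))) => n.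
set a := G l _; set b := G l _.
by rewrite ler_norml; apply/andP; split; nra.
Qed.

Lemma rsum_autocorr k k' : summ (autocorr k k') /\
  rsum (autocorr k k') =
  \sum_(l < L) rsum (fun n => G l (k - n *+ N) * G l (k' - n *+ N)).
Proof. by apply: rsum_sum => l; exact: summ_shiftM. Qed.

Lemma gabor_mxE k p :
  infmx_sum (fun l => infmx_mul (gabor_mx M N (g l) k)
    (infmx_tr (gabor_mx M N (g l) k))) 0 p = rquat (rsum (autocorr k (k + p *+ M))).
Proof.
rewrite (rsum_autocorr _ _).2 rquat_sum; apply: eq_bigr => l _.
rewrite /infmx_mul /infmx_tr /gabor_mx mul0rn addr0.
by rewrite -qsum_rquat; apply: eq_qsum => n; rewrite rquatM -!gE.
Qed.

(** A shift by qN is absorbed by the substitution n -> n + q; this is what carries (b) from residues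
    to all of Z^2. *)
Lemma autocorr_shift k k' q :
  rsum (autocorr (k - q *+ N) (k' - q *+ N)) = rsum (autocorr k k').
Proof.
rewrite -[RHS](@rsum_bij _ _ (fun n => n + q)); last first.
  by exists (fun n => n - q) => n; rewrite ?addrK ?subrK.
apply: eq_rsum => n; rewrite /autocorr /=; apply: eq_bigr => l _.
by rewrite mulrnDl !opprD !addrA !(addrAC _ (- (q *+ N))).
Qed.

(** Division with remainder; the quotient is negated to match the arguments k - nN of the translated
    windows. *)
Lemma residueP (k : Z2) : exists (r : 'I_N * 'I_N) (q : Z2), k = ord_Z2 r - q *+ N.
Proof.
have E (c : int) : exists (r : 'I_N) (q : int), c = Posz r - q *+ N.
  have : 0 <= (c %% N)%Z < N by rewrite modz_ge0 -?lt0n//= ltz_pmod.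
  case Er : (c %% N)%Z => [r|//] /andP[_]; rewrite ltz_nat => rN.
  exists (Ordinal rN), (- (c %/ N)%Z); rewrite /= mulNrn opprK -Er addrC.
  by rewrite -mulr_natr natz -divz_eq.
case: k => a b; have [r [q ->]] := E a; have [s [t ->]] := E b.
exists (r, s), (q, t); congr pair.
- by rewrite /= (raddfMn fst).
- by rewrite /= (raddfMn snd).
Qed.

Lemma residue_inj (r r' : 'I_N * 'I_N) (q q' : Z2) :
  ord_Z2 r - q *+ N = ord_Z2 r' - q' *+ N -> r = r' /\ q = q'.
Proof.
have E (a b : 'I_N) (x y : int) :
    Posz a - x *+ N = Posz b - y *+ N -> a = b /\ x = y.
  move=> h; have ab : a = b.
    apply/val_inj/eqP; rewrite -eqz_nat; apply/eqP.
    have em (c : 'I_N) (z : int) : ((Posz c - z *+ N) %% N)%Z = c.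
      by rewrite addrC -mulNrn -mulr_natr natz modzMDl modz_small ?ltz_nat ?ltn_ord.
    by rewrite -(em a x) h em.
  move: h; rewrite ab => /addrI /oppr_inj /eqP.
  by rewrite eqr_pMn2r// => /eqP.
case: r r' q q' => [a b] [a' b'] [x y] [x' y'] h.
have /= h1 := congr1 fst h; have /= h2 := congr1 snd h.
move: h1 h2; rewrite !(raddfMn fst, raddfMn snd)/= => /E[-> ->] /E[-> ->].
by [].
Qed.

(* The cosets [r - N Z^2], [r] in [{0, ..., N-1}^2], partition [Z^2]. *)
Lemma rsum_residues (f : Z2 -> R) : (forall k, 0 <= f k) -> summ f ->
  rsum f = \sum_(r : 'I_N * 'I_N) rsum (fun n => f (ord_Z2 r - n *+ N)).
Proof.
(* In the extended nonnegative reals the sum can be reindexed by pairs (residue, translation) and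
   then iterated. *)
move=> f0 sf; apply: EFin_inj; rewrite -esum_ge0E// -sumEFin.
rewrite (reindex_esum [set: ('I_N * 'I_N) * Z2] _ (fun x => ord_Z2 x.1 - x.2 *+ N)).
  rewrite (_ : [set: ('I_N * 'I_N) * Z2] =
      [set: 'I_N * 'I_N] `*`` (fun=> [set: Z2])).
    rewrite -(@esum_esum _ _ _ _ _ (fun r n => (f (ord_Z2 r - n *+ N))%:E))//.
      rewrite esum_fset; [|exact: finite_finset|]; last first.
        by move=> r _; apply: esum_ge0 => n _; rewrite lee_fin.
      rewrite (fsbigTE (seq_fset tt (index_enum ('I_N * 'I_N)%type))); last first.
        by move=> r; rewrite seq_fsetE mem_index_enum.
      rewrite (perm_big _ (seq_fset_perm _ _)) undup_id ?index_enum_uniq//.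
      apply: eq_bigr => r _.
      by rewrite esum_ge0E//; exact: summ_shift.
    by move=> *; rewrite lee_fin.
  by apply/seteqP; split.
split=> // [x y _ _ /residue_inj[]|k _]; first by case: x y => ? ? [? ?] /= -> ->.
by have [r [q ->]] := residueP k; exists (r, q).
Qed.

(** Condition (b), with k ranging over all of Z^2 instead of the residues. *)
Definition autocorr_delta := forall k p : Z2,
  rsum (autocorr k (k + p *+ M)) = 1 / M%:R ^+ 2 * (p == 0)%:R.

Lemma autocorr_delta_residues :
  (forall (r : 'I_N * 'I_N) p,
    rsum (autocorr (ord_Z2 r) (ord_Z2 r + p *+ M)) = 1 / M%:R ^+ 2 * (p == 0)%:R) ->
  autocorr_delta.
Proof.
by move=> h k p; have [r [q ->]] := residueP k; rewrite addrAC autocorr_shift.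
Qed.

Lemma nq_gabor l m n k : nq (gabor_system M N g (l, m, n) k) = nq (g l (k - n *+ N)).
Proof.
rewrite /= /modulation /translation !nqM !nq_expq ?mul1r ?mulr1//; first by right.
by left.
Qed.

Lemma subr_bij (n : Z2) : bijective (fun k => k - n).
Proof. by exists (fun k => k + n) => k; rewrite ?addrK ?subrK. Qed.

Lemma l2_gabor a : l2 (gabor_system M N g a).
Proof.
case: a => -[l m] n; apply/l2E; under eq_fun do rewrite nq_gabor.
have /l2E sl := (hg l).1; exact: summ_inj (bij_inj (subr_bij (n *+ N))) sl.
Qed.

Lemma sqn_gabor l m n : sqn (gabor_system M N g (l, m, n)) = sqn (g l).
Proof.
rewrite /sqn -[RHS](rsum_bij _ (subr_bij (n *+ N))).
by apply: eq_rsum => k; rewrite nq_gabor.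
Qed.

(** The cosets of the N^2 residues exhaust Z^2, and each contributes 1/M^2 by the case p = 0. *)
Lemma sum_sqn_window : autocorr_delta ->
  \sum_(l < L) sqn (g l) = N%:R ^+ 2 / M%:R ^+ 2.
Proof.
move=> hd; have nqG l k : nq (g l k) = G l k ^+ 2 by rewrite gE nq_rquat.
transitivity (\sum_(l < L) \sum_(r : 'I_N * 'I_N)
    rsum (fun n => G l (ord_Z2 r - n *+ N) * G l (ord_Z2 r - n *+ N))).
  apply: eq_bigr => l _; rewrite /sqn (eq_rsum (nqG l)) rsum_residues.
  - by apply: eq_bigr.
  - by move=> k; exact: sqr_ge0.
  - exact: summ_sqr.
rewrite exchange_big/= (eq_bigr (fun=> 1 / M%:R ^+ 2)) => [|r _]; last first.
  rewrite -(rsum_autocorr _ _).2; have := hd (ord_Z2 r) 0.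
  by rewrite mul0rn addr0 eqxx mulr1.
by rewrite sumr_const card_prod !card_ord mul1r -[LHS]mulr_natl natrM -expr2.
Qed.

Lemma autocorrC k k' n : autocorr k k' n = autocorr k' k n.
Proof. by apply: eq_bigr => l _; rewrite mulrC. Qed.

Lemma Z2_mulrn (p : Z2) K : p *+ K = (p.1 * K%:Z, p.2 * K%:Z).
Proof.
rewrite [LHS]surjective_pairing; congr pair.
- by rewrite (raddfMn fst) -mulr_natr natz.
- by rewrite (raddfMn snd) -mulr_natr natz.
Qed.

Lemma dvdMP (d : Z2) : reflect (exists p : Z2, d = p *+ M) (dvdM d).
Proof.
apply: (iffP andP) => [[/dvdzP[a h1] /dvdzP[b h2]]|[p ->]].
  by exists (a, b); case: d h1 h2 => x y /= -> ->; rewrite Z2_mulrn.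
by rewrite Z2_mulrn !dvdz_mull.
Qed.

Lemma eq_add_mulrn (k p : Z2) : (k + p *+ M == k) = (p == 0).
Proof.
rewrite -subr_eq0 addrAC subrr add0r.
by rewrite -(inj_eq (mulrnI_Z2 M0) p 0) mul0rn.
Qed.

Lemma orthonormal_basis_autocorr :
  orthonormal_basis (gabor_system M N g) -> autocorr_delta.
Proof.
move=> hb k p; have M2 : 0 < M%:R ^+ 2 :> R by rewrite exprn_gt0// ltr0n.
apply: rsum_unique => [|e A0 e0]; first exact: (rsum_autocorr _ _).1.
(* The kernel at (k + pM, k) is M^2 times a partial sum of the autocorrelation, hence the tolerance
   e M^2. *)
have [s hs] := kernel_cvg l2_gabor hb k (mulr_gt0 e0 M2).
exists (A0 `|` [fset a.2 | a in s])%fset; first exact: fsubsetUl.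
have /hs/(_ (k + p *+ M)) : (s `<=` index_set (A0 `|` [fset a.2 | a in s]))%fset.
  apply/fsubsetP => a sa; rewrite in_index_set inE; apply/orP; right.
  by apply/imfsetP; exists a.
have E1 : k + p *+ M - k = p *+ M by rewrite addrAC subrr add0r.
have dM : dvdM (p *+ M) by apply/dvdMP; exists p.
rewrite kernel_index_set E1 eq_add_mulrn dM /= mulr1.
rewrite (eq_bigr _ (fun n _ => autocorrC (k + p *+ M) k n)).
move: (\sum_(n <- _) _) => S.
have -> : M%:R ^+ 2 * S - (p == 0)%:R =
    (S - 1 / M%:R ^+ 2 * (p == 0)%:R) * M%:R ^+ 2.
  by field; rewrite pnatr_eq0 -lt0n.
by rewrite normrM (gtr0_norm M2) ltr_pM2r.
Qed.

(** If M divides k - k', this is (b) with k = k' + pM; otherwise k differs from k' and both sides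
    vanish. *)
Lemma autocorr_kernel k k' : autocorr_delta ->
  M%:R ^+ 2 * (dvdM (k - k'))%:R * rsum (autocorr k k') = (k == k')%:R.
Proof.
move=> hd; have M2 : M%:R ^+ 2 != 0 :> R by rewrite expf_neq0// pnatr_eq0 -lt0n.
case: dvdMP => [[p kk']|h].
  have -> : rsum (autocorr k k') = rsum (autocorr k' k).
    by apply: eq_rsum => n; exact: autocorrC.
  have -> : k = k' + p *+ M by rewrite -kk' addrC subrK.
  by rewrite hd eq_add_mulrn mulr1 mul1r mulrA mulfV// mul1r.
rewrite mulr0 mul0r; case: eqP => // kk'; case: h; exists 0.
by rewrite kk' subrr mul0rn.
Qed.

(** Each pair (k, k') has its own finite set beyond which the partial sums are close; [B] collects
    these over the finitely many pairs from [S], along with the translations in [A]. *)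
Lemma gabor_resolution : autocorr_delta ->
  resolves_identity (gabor_system M N g).
Proof.
move=> hd A S e e0; have M2 : 0 < M%:R ^+ 2 :> R by rewrite exprn_gt0// ltr0n.
have [F hF] := @choice (Z2 * Z2)%type {fset Z2}
  (fun x A0 => forall B, (A0 `<=` B)%fset ->
    `|\sum_(n <- B) autocorr x.1 x.2 n - rsum (autocorr x.1 x.2)| < e / M%:R ^+ 2)
  (fun x => rsum_approx (rsum_autocorr x.1 x.2).1 (divr_gt0 e0 M2)).
pose B := ([fset a.2 | a in A] `|`
  \bigcup_(k <- S) \bigcup_(k' <- S) F (k, k'))%fset.
exists (index_set B) => [|k k' kS k'S].
  apply/fsubsetP => a sa; rewrite in_index_set inE; apply/orP; left.
  by apply/imfsetP; exists a.
rewrite kernel_index_set; split=> //=; rewrite -(autocorr_kernel k k' hd) -mulrBr.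
have FB : (F (k, k') `<=` B)%fset.
  apply: fsubset_trans (fsubsetUr _ _).
  apply/fsubsetP => n nF; apply/bigfcupP; exists k; first by rewrite kS.
  by apply/bigfcupP; exists k'; first by rewrite k'S.
have := hF (k, k') B FB; rewrite /= ltr_pdivlMr//; apply: le_lt_trans.
rewrite normrM mulrC ler_wpM2l// normrM gtr0_norm//.
by case: (dvdM _); rewrite ?normr1 ?mulr1// normr0 mulr0 ltW.
Qed.

End gabor_kernel.

Theorem theorem5 (R : realType) (L M N : nat)
    (hL : (0 < L)%N) (hM : (0 < M)%N) (hN : (0 < N)%N)
    (g : 'I_L -> Z2 -> quat R)
    (hg : forall l, l2 (g l) /\ real_valued (g l)) :
  orthonormal_basis (gabor_system M N g) <->
  (N ^ 2 = L * M ^ 2)%N /\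
  (forall (k : 'I_N * 'I_N) (p : Z2),
     infmx_sum (fun l => infmx_mul (gabor_mx M N (g l) (ord_Z2 k))
                           (infmx_tr (gabor_mx M N (g l) (ord_Z2 k)))) 0 p =
     rquat ((1 / M%:R ^+ 2) * \1_[set (0 : Z2)] p)).
Proof.
have M2 : M%:R ^+ 2 != 0 :> R by rewrite expf_neq0// pnatr_eq0 -lt0n.
have ind p : \1_[set (0 : Z2)] p = (p == 0)%:R :> R.
  by rewrite indicE; congr (nat_of_bool _)%:R; apply/idP/eqP; rewrite inE.
split=> [hb|[hNL hmx]].
  have hd := orthonormal_basis_autocorr hM hN hg hb.
  split; last by move=> k p; rewrite gabor_mxE// hd ind.
  have := sum_sqn_window hN hg hd.
  rewrite (eq_bigr (fun=> 1)) => [|l _]; last first.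
    have [_ horth _] := hb.
    (* The window g_l has the norm of the system's element with zero modulation and zero
       translation. *)
    rewrite -(sqn_gabor N g l (Ordinal hM, Ordinal hM) 0) -l2_inner_self horth.
    by rewrite eqxx.
  rewrite sumr_const card_ord => /(congr1 ( *%R^~ (M%:R ^+ 2))).
  by rewrite /= divfK// -!natrX -natrM => /eqP; rewrite eqr_nat => /eqP->.
have hd : autocorr_delta M N g.
  apply: autocorr_delta_residues => // r p.
  by have := hmx r p; rewrite gabor_mxE// ind => -[].
have ures := gabor_resolution hM hN hg hd.
have le1 l : sqn (g l) <= 1.
  rewrite -(sqn_gabor N g l (Ordinal hM, Ordinal hM) 0).
  exact: sqn_le1 (l2_gabor N hg) ures _.
(* The terms are nonnegative by [le1], and (a) makes their sum L - N^2/M^2 zero, so each norm is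
   1. *)
have sum0 : \sum_(l < L) (1 - sqn (g l)) = 0.
  rewrite sumrB (sum_sqn_window hN hg hd) sumr_const card_ord.
  by rewrite -natrX hNL natrM natrX mulfK// subrr.
apply: (resolution_orthonormal_basis (l2_gabor N hg) ures).
move=> [[l m] n]; rewrite sqn_gabor//; apply/eqP.
rewrite eq_sym -subr_eq0; apply/eqP.
by apply: (psumr_eq0P _ sum0) => // l' _; rewrite subr_ge0.
Qed.
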